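(* Let $q$ be a prime power and let $r,n,h$ be positive integers such that $h\le r-1$, $h+1$ divides $rn$ and $n\geq h+3$. Let $U$ be an $\frac{rn}{h+1}$-dimensional $\mathbb{F}_q$-subspace of an $r$-dimensional $\mathbb{F}_{q^n}$-vector space $V$. Then $U$ is an $h$-scattered $\mathbb{F}_q$-subspace of $V$ if and only if the ordinary dual $U^{\perp_O}$ satisfies $$\dim_{\mathbb{F}_q}(\langle \mathbf{v}\rangle_{\mathbb{F}_{q^n}}\cap U^{\perp_O})\leq h$$ for every $\mathbf{v}\in V\setminus\{\mathbf{0}\}$.
   Context: **$h$-scattered.** Let $V$ be an $r$-dimensional $\mathbb{F}_{q^n}$-vector space and $h\le r-1$ a positive integer. An $\mathbb{F}_q$-subspace $U$ of $V$ is $h$-scattered if $\langle U\rangle_{\mathbb{F}_{q^n}}=V$ and $\dim_{\mathbb{F}_q}(U\cap H)\le h$ for every $h$-dimensional $\mathbb{F}_{q^n}$-subspace $H$ of $V$. **Ordinary dual.** Let $\sigma:V\times V\to\mathbb{F}_{q^n}$ be a non-degenerate reflexive sesquilinear form and $\sigma'(\mathbf u,\mathbf v)=\mathrm{Tr}_{q^n/q}(\sigma(\mathbf u,\mathbf v))$, a non-degenerate reflexive sesquilinear form on $V$ regarded as an $rn$-dimensional $\mathbb{F}_q$-space. Let $\perp'$ be the orthogonal complement map defined by $\sigma'$ on $\mathbb{F}_q$-subspaces of $V$. Then $U^{\perp_O}$ denotes $U^{\perp'}$ for any such choice of $\sigma$ (different choices give $\mathrm{GL}(V)$-equivalent subspaces).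 *)

(* Defs.v *)
From HB Require Import structures.
From mathcomp Require Import all_boot all_order all_algebra all_fingroup.
From mathcomp Require Import all_solvable all_field.
From mathcomp Require Import sesquilinear.

Set Implicit Arguments.
Unset Strict Implicit.
Unset Printing Implicit Defensive.

Import GRing.Theory.
Local Open Scope ring_scope.

Section RestrictionOfScalars.

Variables (F : fieldType) (L : fieldExtType F) (V : vectType L).

(* The L-vector space V regarded as an F-vector space. *)
Definition baseVectType : Type := V.
Notation V0 := baseVectType.

HB.instance Definition _ := GRing.Zmodule.on V0.

Definition baseVect_scale (a : F) (u : V0) : V0 := (a%:A : L) *: (u : V).

Fact baseVect_scaleA a b u :
  baseVect_scale a (baseVect_scale b u) = baseVect_scale (a * b) u.
Proof. by rewrite /baseVect_scale scalerA -(rmorphM (in_alg L)). Qed.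

Fact baseVect_scale1 : left_id 1 baseVect_scale.
Proof. by move=> u; rewrite /baseVect_scale !scale1r. Qed.

Fact baseVect_scaleDr : right_distributive baseVect_scale +%R.
Proof. by move=> a u v; apply: scalerDr. Qed.

Fact baseVect_scaleDl u : {morph baseVect_scale^~ u : a b / a + b}.
Proof. by move=> a b; rewrite /baseVect_scale -scalerDl -scalerDl. Qed.

HB.instance Definition _ := GRing.Zmodule_isLmodule.Build F V0
  baseVect_scaleA baseVect_scale1 baseVect_scaleDr baseVect_scaleDl.

Lemma baseVect_scaleE (a : F) (u : V) : a *: (u : V0) = (a%:A : L) *: u.
Proof. by []. Qed.

Lemma baseVect_scaleAE (a : F) (x : L) (u : V) :
  a *: ((x *: u : V) : V0) = (a *: x) *: u.
Proof. by rewrite baseVect_scaleE scalerA mulr_algl. Qed.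

Let n := \dim {:L}.
Let bL : n.-tuple L := vbasis {:L}.
Let coordL (x : L) := coord_vbasis (memvf x).

Fact baseVect_vectMixin : Lmodule_hasFinDim F V0.
Proof.
pose bV := vbasis {:V}; set m := \dim {:V} in bV.
pose v2r (x : V0) := mxvec (\matrix_(i, j) coord bL j (coord bV i (x : V))).
have v2r_lin : linear v2r.
  move=> a x y; rewrite -linearP; congr mxvec; apply/matrixP=> i j.
  by rewrite !mxE baseVect_scaleE linearP /= mulr_algl linearP.
pose r2v r : V :=
  \sum_(i < m) (\sum_(j < n) vec_mx r i j *: bL`_j) *: bV`_i.
have v2rK : cancel v2r r2v.
  move=> x; transitivity (\sum_(i < m) coord bV i (x : V) *: bV`_i); last first.
    by rewrite -coord_vbasis ?memvf.
  apply: eq_bigr => i _; rewrite mxvecK; congr (_ *: _ : V).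
  by rewrite (coordL (coord bV i (x : V))); apply: eq_bigr => j _; rewrite mxE.
exists (m * n)%N, v2r => //; exists r2v => // r.
apply: (canLR vec_mxK); apply/matrixP=> i j; rewrite mxE.
by rewrite !coord_sum_free ?(basis_free (vbasisP _)).
Qed.

HB.instance Definition _ := baseVect_vectMixin.

(* An L-subspace of V regarded as an F-subspace (see mem_restrict_vspace). *)
Definition restrict_vspace (H : {vspace V}) : {vspace V0} :=
  <<[seq (tnth bL ij.2 *: tnth (vbasis H) ij.1 : V0) |
      ij : 'I_(\dim H) * 'I_n]>>%VS.

Lemma mem_restrict_vspace (H : {vspace V}) (v : V) :
  (v \in restrict_vspace H) = (v \in H).
Proof.
apply/idP/idP=> [/coord_span->|/coord_vbasis->]; last first.
  apply: (@memv_suml F V0) => i _.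
  rewrite (coordL (coord _ i v)) scaler_suml.
  apply: (@memv_suml F V0) => j _.
  rewrite -baseVect_scaleAE memvZ ?memv_span // -!tnth_nth.
  by apply/imageP; exists (i, j).
apply: (@memv_suml L V) => k _; rewrite nth_image; case: (enum_val k) => i j /=.
by rewrite baseVect_scaleAE memvZ ?vbasis_mem ?mem_tnth.
Qed.

(* The L-span of an F-subspace (characterized by ext_vspace_sub). *)
Definition ext_vspace (U : {vspace V0}) : {vspace V} :=
  <<(vbasis U : seq V0) : seq V>>%VS.

Lemma ext_vspace_sub (U : {vspace V0}) (H : {vspace V}) :
  (ext_vspace U <= H)%VS = (U <= restrict_vspace H)%VS.
Proof.
rewrite -{2}(span_basis (vbasisP U)).
by apply/span_subvP/span_subvP=> sUH u /sUH; rewrite mem_restrict_vspace.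
Qed.

Definition h_scattered (h : nat) (U : {vspace V0}) : Prop :=
  ext_vspace U = {:V}%VS /\
  forall H : {vspace V}, \dim H = h ->
    (\dim (U :&: restrict_vspace H) <= h)%N.

End RestrictionOfScalars.

Arguments baseVectType {F L} V.

Section Trace.

Variables (F : finFieldType) (L : fieldExtType F).

(* Tr_(L/F), with values in the copy F%:A of F inside L; the finite extension
   L is automatically a splitting field. *)
Definition ftrace (x : L) : L :=
  galTrace 1 {:FinSplittingFieldType F L} x.

Lemma ftraceE (x : L) : ftrace x = \sum_(i < \dim {:L}) x ^+ (#|F| ^ i).
Proof.
pose S := FinSplittingFieldType F L.
have sub1 : (1 <= {:S})%VS by apply: sub1v.
have [a /eqP defG Da] := finField_galois_generator sub1.
rewrite dimv1 expn1 in Da.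
have Dai i y : (a ^+ i)%g y = y ^+ (#|F| ^ i).
  elim: i y => [|i IHi] y; first by rewrite gal_id.
  by rewrite expgSr galM ?memvf // IHi Da ?memvf // -exprM expnSr.
have oa : #[a]%g = \dim {:L}.
  rewrite orderE -defG -galois_dim ?finField_galois //.
  by rewrite dimv1 divn1.
have Gim : <[a]>%g = [set (a ^+ (i : 'I_#[a]))%g | i in 'I_#[a]%g].
  apply/setP=> b; apply/idP/imsetP=> [/cyclePmin[i lt_i ->]|[i _ ->]].
    by exists (Ordinal lt_i).
  exact: mem_cycle.
rewrite /ftrace /galTrace defG Gim big_imset /= => [|i j _ _ /eqP]; last first.
  by rewrite eq_expg_mod_order !modn_small // => /eqP/val_inj.
by rewrite -oa; apply: eq_bigr => i _; rewrite Dai.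
Qed.

Lemma ftrace_in1 (x : L) : ftrace x \in 1%VS.
Proof.
exact: (@mem_galTrace F (FinSplittingFieldType F L) 1 {:_} x
         (finField_galois (sub1v _)) (memvf _)).
Qed.

Lemma ftraceD : {morph ftrace : x y / x + y}.
Proof.
move=> x y; rewrite /ftrace /galTrace -big_split /=; apply: eq_bigr => g _.
exact: rmorphD.
Qed.

Lemma ftraceZ (a : F) (x : L) : ftrace (a *: x) = a *: ftrace x.
Proof.
rewrite /ftrace /galTrace scaler_sumr; apply: eq_bigr => g _.
exact: linearZ.
Qed.

End Trace.

Section OrdinaryDual.

Variables (F : finFieldType) (L : fieldExtType F) (V : vectType L).
Variables (theta : {rmorphism L -> L}).
Variable sigma : {bilinear V -> V -> L | *%R & theta \; *%R}.

Definition reflexive_form : Prop := forall u v, sigma u v = 0 -> sigma v u = 0.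

Definition nondegenerate_form : Prop :=
  forall u, (forall v, sigma u v = 0) -> u = 0.

Definition trace_form (u v : baseVectType V) : L := ftrace (sigma u v).

(* The F-subspace of the v such that trace_form v u = 0 for all u in U (see
   mem_ordinary_dualP); as for orthov, it suffices to test a basis of U, and
   the argument in which the form is linear is the one being solved for. *)
Definition ordinary_dual (U : {vspace baseVectType V}) :
    {vspace baseVectType V} :=
  (\bigcap_(i < \dim U) lker (linfun (trace_form^~ (vbasis U)`_i)))%VS.

Lemma trace_form_linearl (u : baseVectType V) : linear (trace_form^~ u).
Proof.
move=> a v w; rewrite /trace_form baseVect_scaleE linearPl ftraceD.
by rewrite mulr_algl ftraceZ.
Qed.

Lemma trace_formDr (v : baseVectType V) : {morph trace_form v : x y / x + y}.
Proof. by move=> x y; rewrite /trace_form linearDr ftraceD. Qed.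

Lemma trace_formZr (v u : baseVectType V) (a : F) :
  trace_form v (a *: u) = theta a%:A * trace_form v u.
Proof.
rewrite /trace_form baseVect_scaleE linearZr_LR /=.
have /vlineP[b ->]: theta a%:A \in 1%VS.
  rewrite (Fermat's_little_theorem 1%AS) -rmorphXn /= dimv1 expn1.
  by rewrite -in_algE -rmorphXn expf_card.
by rewrite !mulr_algl ftraceZ.
Qed.

Lemma mem_ordinary_dualP (U : {vspace baseVectType V}) (v : baseVectType V) :
  reflect (forall u, u \in U -> trace_form v u = 0) (v \in ordinary_dual U).
Proof.
have lE u w : linfun (trace_form^~ u) w = trace_form w u.
  pose lM := GRing.isLinear.Build _ _ _ _ _ (trace_form_linearl u).
  pose l : {linear _ -> _} := HB.pack (trace_form^~ u) lM.
  exact: (lfunE l).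
apply: (iffP idP) => [vU u /coord_vbasis->|vU]; last first.
  rewrite memvE; apply/subv_bigcapP=> i _.
  by rewrite -memvE memv_ker lE vU // vbasis_mem ?mem_nth ?size_tuple.
have tf0 : trace_form v 0 = 0.
  by rewrite -[0 in LHS](scale0r 0) trace_formZr scale0r rmorph0 mul0r.
rewrite (big_morph _ (trace_formDr v) tf0) big1 // => i _.
move: vU; rewrite memvE => /subv_bigcapP/(_ i isT).
by rewrite -memvE memv_ker lE trace_formZr => /eqP->; rewrite mulr0.
Qed.

End OrdinaryDual.

(* Main.v *)
From HB Require Import structures.
Require Import Defs.
From mathcomp Require Import all_boot all_order all_algebra all_field.
From mathcomp Require Import fingroup sesquilinear.

(** Write F = F_q, L = F_(q^n) and k = dim_F U, so that (h+1) k = r n. Both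
sides of the equivalence are compared with the behaviour of the F-subspaces
b_0 U, ..., b_h U of V, for an F-free family b = (b_0, ..., b_h) in L. Each
b_i U has dimension k, hence the sum of the b_i U is direct if and only if it
is the whole of V, a space of F-dimension r n.

- The subspace U is h-scattered if and only if every such sum is direct.
First, dim_F (U :&: H) <= h for all h-dimensional L-subspaces H says that
h+1 vectors of U that are independent over F are independent over L
([cap_le_iff_free_over_ext]). Second, a relation \sum_i b_i u_i = 0 with
u_i = \sum_j c_ij w_j reads \sum_j (\sum_i c_ij b_i) w_j = 0, and this
exchanges a relation between elements of U with F-free coefficients in L for a
relation between F-free elements of U with coefficients in L
([free_over_ext_iff_directv]). The requirement that U span V over L comes for
free, because the sum of the b_i U, which is then V, lies in the L-span of U.

- The bound on the dual says that every such sum is V: the sum is proper if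
and only if some v != 0 is orthogonal to all the b_i U for the trace form,
that is, if theta(b_i) v belongs to the dual of U for all i; since theta
preserves F-freeness, these are h+1 F-free vectors in the intersection of the
line <v> with the dual ([dual_cap_le_iff_sum_full]).

In coding terms, this is the theorem that the dual of an MRD code is MRD: a
square linear system is injective exactly when its transpose is. *)

Set Implicit Arguments.
Unset Strict Implicit.
Unset Printing Implicit Defensive.

Import GRing.Theory.
Local Open Scope ring_scope.

(** * Free families inside a subspace *)

Section Subspaces.

Variables (K : fieldType) (vT : vectType K).

Lemma vspace_between (A B : {vspace vT}) (m : nat) :
    (A <= B)%VS -> (\dim A <= m <= \dim B)%N ->
  exists W : {vspace vT}, [/\ (A <= W)%VS, (W <= B)%VS & \dim W = m].
Proof.
move=> sAB /andP[leAm lemB]; pose C := (B :\: A)%VS; pose k := (m - \dim A)%N.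
have dimC : (\dim A + \dim C)%N = \dim B.
  by rewrite -(dimv_cap_compl B A) (capv_idPr sAB).
pose X := take k (vbasis C).
have sXC : (<<X>> <= C)%VS.
  by apply/span_subvP=> x /mem_take Xx; rewrite vbasis_mem.
have dimX : \dim <<X>> = k.
  have freeX : free X.
    apply: (catl_free (Y := drop k (vbasis C))).
    by rewrite cat_take_drop (basis_free (vbasisP _)).
  rewrite (eqP freeX) size_takel // size_tuple.
  by rewrite leq_subLR dimC.
exists (A + <<X>>)%VS; split; first exact: addvSl.
  by rewrite subv_add sAB (subv_trans sXC) ?diffvSl.
rewrite dimv_disjoint_sum ?dimX ?subnKC //.
by apply/eqP; rewrite -subv0 -(capv_diff B A) capvC capvS.
Qed.

Lemma free_subspace_tuple (m : nat) (U : {vspace vT}) :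
  (m <= \dim U)%N -> exists2 w : m.-tuple vT, free w & {subset w <= U}.
Proof.
move=> lemU.
have [|W [_ sWU dimW]] := @vspace_between 0 U m (sub0v U).
  by rewrite dimv0.
move: (vbasis W) (vbasisP W); rewrite dimW => w wP; exists w.
  exact: basis_free wP.
by move=> x wx; apply: (subvP sWU); exact: (basis_mem wP wx).
Qed.

(** The u_i may be dependent: they are expanded on a basis of an m-dimensional
subspace squeezed between their span and U. *)
Lemma family_in_free_tuple (m : nat) (U : {vspace vT}) (u : 'I_m -> vT) :
    (m <= \dim U)%N -> (forall i, u i \in U) ->
  exists2 w : m.-tuple vT, free w & {subset w <= U} /\
    exists c : 'I_m -> 'I_m -> K, forall i, u i = \sum_j c i j *: w`_j.
Proof.
move=> lemU Uu; pose A := <<[seq u i | i : 'I_m]>>%VS.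
have sAU : (A <= U)%VS by apply/span_subvP=> _ /codomP[i ->].
have leAm : (\dim A <= m)%N.
  by rewrite (leq_trans (dim_span _)) // size_image card_ord.
have [|W [sAW sWU dimW]] := vspace_between sAU (m := m); first by rewrite leAm.
move: (vbasis W) (vbasisP W); rewrite dimW => w wP.
exists w; first exact: basis_free wP.
split=> [x wx|]; first by apply: (subvP sWU); exact: (basis_mem wP wx).
exists (fun i j => coord w j (u i)) => i; apply: (coord_basis wP).
by apply: (subvP sAW); rewrite memv_span ?codom_f.
Qed.

(** Imposing f i = 0 lowers the dimension by at most the rank of f i. *)
Lemma dim_bigcap_lker (I : finType) (rT : vectType K) (f : I -> 'Hom(vT, rT)) :
  (\dim {:vT} <= \sum_i \dim (limg (f i)) + \dim (\bigcap_i lker (f i))%VS)%N.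
Proof.
elim/big_rec2: _ => [|i A s _ IH]; first by rewrite add0n.
rewrite (leq_trans IH) // (addnC _ s) -addnA leq_add2l.
rewrite -(limg_ker_dim (f i) A) capvC addnC leq_add2r.
exact/dimvS/limgS/subvf.
Qed.

End Subspaces.

(** * Freeness over the extension and sums of homothetic subspaces *)

Section RestrictedScalars.

Variables (F : fieldType) (L : fieldExtType F) (V : vectType L).
Notation V0 := (baseVectType V).

Definition homothety_fun (b : L) (v : V0) : V0 := b *: (v : V).

Fact homothety_is_linear b : linear (homothety_fun b).
Proof.
move=> a u v.
by rewrite /homothety_fun !baseVect_scaleE scalerDr !scalerA mulrC.
Qed.

HB.instance Definition _ b :=
  GRing.isLinear.Build F V0 V0 *:%R (homothety_fun b) (homothety_is_linear b).

Definition homothety (b : L) : 'End(V0) := linfun (homothety_fun b).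

Lemma homothetyE b (v : V) : homothety b v = b *: v.
Proof. exact: lfunE. Qed.

Definition line_fun (v : V) (x : L) : V0 := x *: v.

Fact line_fun_is_linear v : linear (line_fun v).
Proof.
by move=> a x y; rewrite /line_fun scalerDl -baseVect_scaleAE.
Qed.

HB.instance Definition _ v :=
  GRing.isLinear.Build F L V0 *:%R (line_fun v) (line_fun_is_linear v).

Definition line_map (v : V) : 'Hom(L, V0) := linfun (line_fun v).

Lemma line_mapE v x : line_map v x = x *: v.
Proof. exact: lfunE. Qed.

Lemma lker_line_map v : v != 0 -> lker (line_map v) = 0%VS.
Proof.
move=> nz_v; apply/eqP/lker0P=> x y; rewrite !line_mapE => xy; apply/eqP.
have: (x - y) *: v == 0 by rewrite scalerBl xy subrr.
by rewrite scaler_eq0 (negPf nz_v) orbF subr_eq0.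
Qed.

Lemma limg_line_map v : limg (line_map v) = restrict_vspace <[v]>.
Proof.
apply/vspaceP=> u; rewrite mem_restrict_vspace.
apply/memv_imgP/vlineP=> [[x _ ->]|[x ->]]; exists x; rewrite ?memvf //.
  exact: line_mapE.
by rewrite line_mapE.
Qed.

Lemma lker_homothety b : b != 0 -> lker (homothety b) = 0%VS.
Proof.
move=> nz_b; apply/eqP/lker0P=> x y; rewrite !homothetyE; exact: (@scalerI _ V).
Qed.

(** An L-basis (e_i) of V splits V into the lines L e_i, each isomorphic to L
over F. *)
Lemma dim_baseVect : \dim {:V0} = (\dim {:V} * \dim {:L})%N.
Proof.
have freeV : free (vbasis {:V}) := basis_free (vbasisP _).
pose ell (i : 'I_(\dim {:V})) := limg (line_map (vbasis {:V})`_i).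
have dxl : directv (\sum_i ell i).
  apply/directv_sum_independent=> us lus.
  have /fin_all_exists[x Dus] i : exists x : L,
      us i = x *: ((vbasis {:V})`_i : V).
    by have /memv_imgP[x _ ->] := lus i isT; exists x; rewrite line_mapE.
  rewrite (eq_bigr _ (fun i _ => Dus i)) => x0 i _.
  by rewrite Dus (freeP freeV x x0) scale0r.
have -> : fullv = (\sum_i ell i)%VS.
  apply/eqP; rewrite eqEsubv subvf andbT; apply/subvP=> v _.
  rewrite (coord_vbasis (memvf (v : V))); apply: (@memv_suml F V0) => i _.
  apply: (subvP (sumv_sup i _ (subvv _))) => //.
  apply/memv_imgP; exists (coord (vbasis {:V}) i (v : V)); first exact: memvf.
  by rewrite line_mapE.
rewrite (directvP dxl) /= (eq_bigr (fun=> \dim {:L})) => [|i _].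
  by rewrite sum_nat_const card_ord.
rewrite limg_dim_eq ?lker_line_map ?capv0 //.
by rewrite (free_not0 freeV) // mem_nth // size_tuple.
Qed.

(** The element \sum_(i,j) c_ij (b_i (x) w_j) of L (x) V, evaluated in V by
grouping the terms along either factor. *)
Lemma scale_sum_swap (I J : finType) (b : I -> L) (w : J -> V)
    (c : I -> J -> F) :
  \sum_i b i *: (\sum_j c i j *: (w j : V0) : V) =
  \sum_j (\sum_i c i j *: b i) *: w j.
Proof.
under eq_bigr => i _ do
  rewrite (scaler_sumr (b i) _ _ (fun j => c i j *: (w j : V0))).
rewrite exchange_big; apply: eq_bigr => j _; rewrite scaler_suml.
apply: eq_bigr => i _.
by rewrite baseVect_scaleE scalerA mulrC mulr_algl.
Qed.

(** If F-free vectors w_0, ..., w_h of U are dependent over L, their L-span has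
dimension at most h and can be enlarged to some H of dimension exactly h, which
is where h <= dim V is needed; then U meets H in dimension more than h. *)
Lemma cap_le_iff_free_over_ext (h : nat) (U : {vspace V0}) :
    (h <= \dim {:V})%N ->
  (forall H : {vspace V}, \dim H = h ->
     (\dim (U :&: restrict_vspace H) <= h)%N) <->
  (forall w : h.+1.-tuple V0, free w -> {subset w <= U} ->
     @free L V w).
Proof.
move=> lehV; split=> [capU w frw sWU | frU H dimH].
  rewrite /free eqn_leq dim_span size_tuple ltnNge /=; apply/negP=> dimw.
  pose W : {vspace V} := <<w : seq V>>%VS.
  have [|H [swH _ dimH]] := vspace_between (subvf W) (m := h).
    by rewrite dimw.
  have := capU H dimH; rewrite leqNgt; case/negP.
  rewrite -(size_tuple w) -(eqP frw) dimvS // subv_cap.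
  apply/andP; split; first exact/span_subvP.
  apply/span_subvP=> x wx.
  by rewrite mem_restrict_vspace (subvP swH) // memv_span.
rewrite leqNgt; apply/negP=> /free_subspace_tuple[w frw sw].
have frLw : @free L V w.
  by apply: frU => // x /sw; rewrite memv_cap => /andP[].
suff : (\dim <<w : seq V>>%VS <= \dim H)%N.
  by rewrite dimH (eqP frLw) size_tuple ltnn.
apply: dimvS; apply/span_subvP=> x /sw.
by rewrite memv_cap mem_restrict_vspace => /andP[].
Qed.

(** A tensor of rank at most m in L (x) U is a sum of m pure tensors with F-free
left factors, and also a sum of m pure tensors with F-free right factors; the
bounds on m leave room for these free families. Both conditions say that no
nonzero tensor of rank at most m is mapped to 0 in V. *)
Lemma free_over_ext_iff_directv (m : nat) (U : {vspace V0}) :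
    (m <= \dim {:L})%N -> (m <= \dim U)%N ->
  (forall w : m.-tuple V0, free w -> {subset w <= U} -> @free L V w) <->
  (forall b : m.-tuple L, free b ->
     directv (\sum_(i < m) (homothety b`_i @: U))).
Proof.
move=> lemL lemU; split=> [frU b frb | dxU w frw sWU].
  apply/directv_sum_independent=> us Uus us0.
  have /fin_all_exists[u Du] i : exists u : V0,
      u \in U /\ us i = b`_i *: (u : V).
    by have /memv_imgP[u Uu ->] := Uus i isT; exists u; rewrite homothetyE.
  have [w frw [sWU [c Dc]]] :=
    family_in_free_tuple lemU (fun i => (Du i).1).
  have c0 j : forall i, c i j = 0.
    apply: (freeP frb (c^~ j)).
    have := freeP (frU w frw sWU) (fun j => \sum_i c i j *: b`_i).
    rewrite -scale_sum_swap; apply; rewrite -[RHS]us0; apply: eq_bigr => i _.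
    by rewrite (Du i).2 Dc.
  move=> i _; rewrite (Du i).2 Dc big1 ?scaler0 // => j _.
  by rewrite c0 scale0r.
apply/freeP => k k0.
have [b frb [_ [c Dc]]] := family_in_free_tuple lemL (fun i => memvf (k i)).
have c0 : forall i, \sum_j c j i *: w`_j = 0 :> V0.
  move=> i; pose us (i : 'I_m) := homothety b`_i (\sum_j c j i *: w`_j).
  have Uus l : us l \in (homothety b`_l @: U)%VS.
    apply/memv_img/memv_suml => j _; rewrite memvZ // sWU //.
    by rewrite mem_nth // size_tuple.
  have us0 : \sum_l us l = 0.
    rewrite -[RHS]k0 (eq_bigr _ (fun i _ => homothetyE _ _)).
    rewrite (scale_sum_swap _ _ (fun i j => c j i)).
    by apply: eq_bigr => j _; rewrite -Dc.
  have /directv_sum_independent dxb := dxU b frb.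
  apply: (@scalerI _ V b`_i).
    by rewrite (free_not0 frb) // mem_nth // size_tuple.
  rewrite scaler0 -homothetyE; exact: (dxb us).
move=> j; rewrite Dc big1 // => i _.
by rewrite (freeP frw (c^~ i) (c0 i)) scale0r.
Qed.

End RestrictedScalars.

(** * The dual for the trace form *)

Section Dual.

Variables (F : finFieldType) (L : fieldExtType F) (V : vectType L).
Variables (theta : {rmorphism L -> L}).
Variable sigma : {bilinear V -> V -> L | *%R & theta \; *%R}.
Hypothesis sigma_nondeg : nondegenerate_form sigma.
Notation V0 := (baseVectType V).
Implicit Types (U W : {vspace V0}) (v : V).

(** By linear independence of the automorphisms in the Galois group. *)
Lemma ftrace_neq0 : exists x : L, ftrace x != 0.
Proof.
have [|a _] := @gal_independent_contra F (FinSplittingFieldType F L) {:_}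
  [in 'Gal({:_} / 1)%g] (fun=> 1) 1%g (group1 _); first exact: oner_neq0.
by under eq_bigr do rewrite mul1r; exists a.
Qed.

Lemma fin_rmorph_bij : bijective theta.
Proof.
exact: (@injF_bij (finvect_type L) theta (fmorph_inj theta)).
Qed.

(** The subfield F of L is the set of solutions of x ^+ #|F| = x, an equation
that any ring morphism preserves. *)
Lemma fin_rmorph_mem1 x : (theta x \in 1%VS) = (x \in 1%VS).
Proof.
rewrite !(Fermat's_little_theorem 1%AS) -rmorphXn /=.
exact/inj_eq/fmorph_inj.
Qed.

Lemma dim_ordinary_dual W :
  (\dim {:V0} <= \dim W + \dim (ordinary_dual sigma W))%N.
Proof.
pose f (i : 'I_(\dim W)) := linfun ((trace_form sigma)^~ (vbasis W)`_i).
apply: leq_trans (dim_bigcap_lker f) _; rewrite leq_add2r.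
rewrite -[leqRHS]card_ord -sum1_card leq_sum // => i _.
rewrite -[leqRHS](dimv1 L) dimvS //; apply/subvP=> _ /memv_imgP[v _ ->].
set u := (vbasis W)`_i.
pose lM := GRing.isLinear.Build _ _ _ _ _ (trace_form_linearl sigma u).
pose l : {linear _ -> _} := HB.pack ((trace_form sigma)^~ u) lM.
by rewrite (lfunE l) ftrace_in1.
Qed.

(** If W is proper, a dimension count leaves a nonzero vector in its dual. For
W = V, let Tr (sigma v u) vanish for all u: replacing u with y u multiplies
sigma v u by theta y, an arbitrary element of L, so sigma v u != 0 would force
the trace to be identically zero. *)
Lemma ordinary_dual_eq0 W : (ordinary_dual sigma W == 0%VS) = (W == fullv).
Proof.
apply/eqP/eqP=> [W0 | ->].
  apply/eqP; rewrite eqEdim subvf /=.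
  by have := dim_ordinary_dual W; rewrite W0 dimv0 addn0.
apply/eqP; rewrite -subv0; apply/subvP=> v /mem_ordinary_dualP v0.
rewrite memv0; apply/eqP/sigma_nondeg => u.
apply/eqP; apply: contraT => nz_vu; have [x /eqP[]] := ftrace_neq0.
have [theta' _ thetaK] := fin_rmorph_bij; pose y := theta' (x / sigma v u).
have := v0 (y *: (u : V)) (memvf _).
by rewrite /trace_form linearZr_LR /= thetaK divfK.
Qed.

(** Homotheties are adjoint to homotheties: both Tr (sigma v (b u)) and
Tr (sigma (theta b v) u) are the trace of theta b * sigma v u. *)
Lemma mem_dual_homothety b U v :
  ((v : V0) \in ordinary_dual sigma (homothety V b @: U)) =
  ((theta b *: v : V0) \in ordinary_dual sigma U).
Proof.
have adj (u : V0) : trace_form sigma v (homothety V b u) =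
    trace_form sigma (theta b *: v : V0) u.
  by rewrite homothetyE /trace_form linearZr_LR linearZl_LR.
apply/mem_ordinary_dualP/mem_ordinary_dualP=> [vbU u Uu | bvU bu].
  by rewrite -adj vbU ?memv_img.
case/memv_imgP=> u Uu ->.
by rewrite adj bvU.
Qed.

Lemma mem_dual_sum (I : finType) (Us : I -> {vspace V0}) (v : V0) :
  reflect (forall i, v \in ordinary_dual sigma (Us i))
    (v \in ordinary_dual sigma (\sum_i Us i)%VS).
Proof.
apply: (iffP idP) => [/mem_ordinary_dualP vUs i | vUs].
  apply/mem_ordinary_dualP=> u Uu; apply: vUs.
  exact: (subvP (sumv_sup i _ (subvv _))).
apply/mem_ordinary_dualP=> _ /memv_sumP[u Uu ->].
have tf0 : trace_form sigma v 0 = 0.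
  by rewrite -[0 in LHS](scale0r 0) trace_formZr scale0r rmorph0 mul0r.
rewrite (big_morph _ (trace_formDr sigma v) tf0) big1 // => i _.
by move/mem_ordinary_dualP: (vUs i); apply; apply: Uu.
Qed.

(** Although theta need not fix F pointwise, it permutes F, so it carries linear
relations over F to linear relations over F, as does its inverse. *)
Lemma free_map_rmorph (m : nat) (b : m.-tuple L) :
  free (map_tuple theta b) = free b.
Proof.
have bE (i : 'I_m) : (map_tuple theta b)`_i = theta b`_i.
  by rewrite (nth_map 0) // size_tuple.
have [theta' thetaK theta'K] := fin_rmorph_bij.
apply/freeP/freeP=> frb k k0 i.
  have /fin_all_exists[c Dc] j : exists c : F, theta (k j)%:A = c%:A.
    by apply/vlineP; rewrite fin_rmorph_mem1 memvZ ?memv_line.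
  have /(_ i) ci0 : forall j, c j = 0.
    apply: frb; rewrite -[RHS](rmorph0 theta) -[in RHS]k0 rmorph_sum.
    apply: eq_bigr => j _; rewrite bE -[in RHS]mulr_algl rmorphM Dc.
    by rewrite mulr_algl.
  apply/(fmorph_inj (in_alg L))/(fmorph_inj theta).
  by rewrite /= Dc ci0 !scale0r rmorph0.
have /fin_all_exists[c Dc] j : exists c : F, theta' (k j)%:A = c%:A.
  by apply/vlineP; rewrite -fin_rmorph_mem1 theta'K memvZ ?memv_line.
have /(_ i) ci0 : forall j, c j = 0.
  apply: frb; apply: (fmorph_inj theta); rewrite rmorph_sum rmorph0 -[RHS]k0.
  apply: eq_bigr => j _; rewrite bE -mulr_algl rmorphM -Dc theta'K.
  by rewrite mulr_algl.
apply/(fmorph_inj (in_alg L)).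
by rewrite /= -[LHS]theta'K Dc ci0 !scale0r rmorph0.
Qed.

(** The vectors v orthogonal to the sum of the b_i U are those for which the
(h+1)-dimensional space spanned by the theta (b_i) v lies in the dual of U, and
every free family in L has the form theta (b_i). *)
Lemma dual_cap_le_iff_sum_full (h : nat) U :
  (forall v : V, v != 0 ->
     (\dim (restrict_vspace <[v]> :&: ordinary_dual sigma U) <= h)%N) <->
  (forall b : h.+1.-tuple L, free b ->
     (\sum_(i < h.+1) (homothety V b`_i @: U))%VS = fullv).
Proof.
have bthE (b : h.+1.-tuple L) i v :
    ((v : V0) \in ordinary_dual sigma (homothety V b`_i @: U)) =
    (line_map v (theta b`_i) \in ordinary_dual sigma U).
  by rewrite mem_dual_homothety line_mapE.
split=> [capU b frb | fullU v nz_v].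
  apply/eqP; rewrite -ordinary_dual_eq0 -subv0; apply/subvP=> v.
  move/mem_dual_sum=> vU; rewrite memv0; apply: contraT => nz_v.
  have := capU v nz_v; rewrite leqNgt => /negP[].
  rewrite -limg_line_map.
  pose A := <<map_tuple theta b>>%VS.
  have dimA : \dim A = h.+1.
    by rewrite (eqnP (_ : free _)) ?free_map_rmorph // size_tuple.
  rewrite -dimA -(@limg_dim_eq _ _ _ (line_map v) A); last first.
    by rewrite lker_line_map // capv0.
  apply: dimvS; rewrite subv_cap limgS ?subvf // limg_span.
  apply/span_subvP=> _ /mapP[_ /mapP[x bx ->] ->].
  have [i lti <-] := nthP 0 bx; rewrite size_tuple in lti.
  by rewrite -(bthE b i) (vU (Ordinal lti)).
rewrite leqNgt -limg_line_map; apply/negP.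
rewrite capvC -(lpreimK (capvSr _ _)) limg_dim_eq; last first.
  by rewrite lker_line_map // capv0.
case/free_subspace_tuple=> c frc cU.
have [theta' _ theta'K] := fin_rmorph_bij.
pose b := map_tuple theta' c.
have Dc : map_tuple theta b = c.
  by apply/val_inj; rewrite /= -map_comp map_id_in // => x _; apply: theta'K.
have frb : free b by rewrite -free_map_rmorph Dc.
have /negP[] := nz_v; rewrite -[_ == _](memv0 (v : V0)).
have /eqP<- : ordinary_dual sigma fullv == 0%VS by rewrite ordinary_dual_eq0.
rewrite -(fullU b frb); apply/mem_dual_sum=> i.
have lti : (i < size b)%N by rewrite size_tuple.
rewrite bthE -(nth_map 0 0 theta) //.
have : (map_tuple theta b)`_i \in c.
  by rewrite -[X in _ \in X]Dc mem_nth // size_map.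
by move/cU; rewrite -memv_preim memv_cap => /andP[].
Qed.

End Dual.

(** * The equivalence *)

Theorem corollary5p4 (F : finFieldType) (L : fieldExtType F) (V : vectType L)
    (r n h : nat)
    (dimL : \dim {:L} = n) (dimV : \dim {:V} = r)
    (r_gt0 : (0 < r)%N) (n_gt0 : (0 < n)%N) (h_gt0 : (0 < h)%N)
    (h_le : (h <= r - 1)%N)
    (h_dvd : (h + 1 %| r * n)%N)
    (n_ge : (h + 3 <= n)%N)
    (theta : {rmorphism L -> L})
    (sigma : {bilinear V -> V -> L | *%R & theta \; *%R})
    (sigma_nondegenerate : nondegenerate_form sigma)
    (sigma_reflexive : reflexive_form sigma)
    (U : {vspace baseVectType V})
    (dimU : \dim U = (r * n %/ (h + 1))%N) :
  h_scattered h U <->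
  (forall v : V, v != 0 ->
     (\dim (restrict_vspace <[v]> :&: ordinary_dual sigma U) <= h)%N).
Proof.
rewrite addn1 in h_dvd dimU.
have dimUh : (h.+1 * \dim U)%N = \dim {:baseVectType V}.
  by rewrite dim_baseVect dimL dimV dimU mulnC divnK.
have lthn : (h < n)%N by apply: leq_trans n_ge; rewrite addn3 ltnS leqW.
have lthr : (h < r)%N by rewrite -(subnK r_gt0) addn1 ltnS.
have lthU : (h < \dim U)%N.
  rewrite (leq_trans lthn) // -(leq_pmul2l (ltn0Sn h)) dimUh dim_baseVect.
  by rewrite dimL dimV leq_mul2r lthr orbT.
have directv_full (b : h.+1.-tuple L) : free b ->
    directv (\sum_(i < h.+1) (homothety V b`_i @: U)) =
    ((\sum_(i < h.+1) (homothety V b`_i @: U))%VS == fullv).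
  move=> frb; rewrite directvE /= (eq_bigr (fun=> \dim U)) => [|i _].
    by rewrite sum_nat_const card_ord dimUh (dimv_leqif_eq (subvf _)).2.
  rewrite limg_dim_eq // lker_homothety ?capv0 //.
  by rewrite (free_not0 frb) // mem_nth // size_tuple.
apply: iff_trans (iff_sym (dual_cap_le_iff_sum_full sigma_nondegenerate h U)).
have le_hV : (h <= \dim {:V})%N by rewrite dimV ltnW.
have lt_hL : (h < \dim {:L})%N by rewrite dimL.
have caps_directv := iff_trans (cap_le_iff_free_over_ext U le_hV)
  (free_over_ext_iff_directv lt_hL lthU).
split=> [[_ /caps_directv dxU] b frb | fullU].
  by apply/eqP; rewrite -directv_full ?dxU.
split; last by apply/caps_directv=> b frb; rewrite directv_full // fullU.
(* U spans V over L: any one of the sums of the b_i U does. *)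
have [b frb _] := free_subspace_tuple lt_hL.
apply/eqP; rewrite eqEsubv subvf /=; apply/subvP=> v _.
have := memvf (v : baseVectType V); rewrite -(fullU b frb).
move=> /memv_sumP[us Uus ->].
apply: (@memv_suml L V) => i _; have /memv_imgP[u Uu ->] := Uus i isT.
rewrite homothetyE memvZ //.
rewrite -mem_restrict_vspace; apply: subvP Uu.
by rewrite -ext_vspace_sub.
Qed.
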